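(* Let $G$ be a finite $r$-generator UCS $p$-group of exponent $p^2$ where $p>2$, and let $L=\mathcal L(G)$. Then $\mathrm{Aut}(G)/\mathrm{Aut}_C(G)\cong\mathrm{Aut}(L)$, where $\mathrm{Aut}_C(G)$ is elementary abelian of order $p^{r^2}$.
   Context: Here $p$ is a prime, and $r$-generator means that $r$ is the minimal number of generators of $G$. A group is UCS if it has a unique non-trivial proper characteristic subgroup. $\mathrm{Aut}_C(G)$, the group of central automorphisms, is the kernel of the natural homomorphism $\mathrm{Aut}(G)\to\mathrm{Aut}(G/Z(G))$, where $Z(G)$ is the center of $G$. Definition of $\mathcal L(G)$: let $G$ be a finite UCS $p$-group of exponent $p^2$ ($p$ odd), $\Phi(G)$ its Frattini subgroup, $\overline G=G/\Phi(G)$ (an $\mathbb F_p$-vector space), $\overline g=g\Phi(G)$. It is known that $\overline g\mapsto g^p$ is a well-defined isomorphism $\overline G\to\Phi(G)$; for $h\in\Phi(G)$, let $h^{1/p}\in\overline G$ be its unique preimage. Then $\mathcal L(G)$ is the $\mathbb F_p$-algebra with underlying space $\overline G$ and product $\llbracket\overline x,\overline y\rrbracket=[x,y]^{1/p}$, where $[x,y]=x^{-1}y^{-1}xy$. $\mathrm{Aut}(L)$ is the automorphism group of this algebra.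
   Formalization: G is assumed non-abelian; for abelian G the claim always fails, e.g. for G cyclic of order p^2, where Aut_C(G) = Aut(G) has order p(p-1) rather than p. *)

(* Defs.v *)
From HB Require Import structures.
From mathcomp Require Import all_boot all_order all_algebra all_fingroup.
From mathcomp Require Import all_solvable.

Set Implicit Arguments.
Unset Strict Implicit.
Unset Printing Implicit Defensive.

Import GroupScope GRing.Theory.

Definition UCS (gT : finGroupType) (G : {group gT}) : Prop :=
  exists! H : {group gT}, [/\ H \char G, H :!=: 1 & H \proper G].

Section CentralAutomorphisms.

Variables (gT : finGroupType) (G : {group gT}).

(* The natural map Aut G -> Aut (G / 'Z(G)); the three lemmas below identify  *)
(* its domain, its values and its codomain.                                   *)
Definition aut_modZ :
    {morphism qact_dom [Aut G] 'Z(G) >-> {perm coset_of 'Z(G)}} :=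
  actperm_morphism ([Aut G] / 'Z(G)).

Lemma aut_modZ_dom : qact_dom [Aut G] 'Z(G) = Aut G.
Proof.
rewrite qact_domE ?subsetIl //; apply/setP=> a.
rewrite in_setI; case Aa: (a \in Aut G) => //=.
have act_a x : x \in G -> [Aut G]%act x a = a x by [].
rewrite inE; apply/subsetP=> x Zx; rewrite inE /=.
have Gx : x \in G by case/setIP: Zx.
have /forall_inP/(_ a Aa) := proj2 (andP (center_char G)).
by move/subsetP; apply; apply/imsetP; exists x.
Qed.

Lemma aut_modZE a x :
  a \in Aut G -> x \in G -> aut_modZ a (coset 'Z(G) x) = coset 'Z(G) (a x).
Proof.
move=> Aa Gx; rewrite actpermE qactE ?aut_modZ_dom //.
exact: subsetP (normal_norm (center_normal G)) x Gx.
Qed.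

Lemma aut_modZ_Aut a : a \in Aut G -> aut_modZ a \in Aut (G / 'Z(G)).
Proof.
move=> Aa; pose to := ([Aut G] / 'Z(G))%gact.
have aD : a \in qact_dom [Aut G] 'Z(G) by rewrite aut_modZ_dom.
have := actperm_Aut to aD.
by [].
Qed.

Definition AutC : {set {perm gT}} := 'ker aut_modZ.
Canonical AutC_group : {group {perm gT}} := Eval hnf in [group of AutC].

Lemma AutC_normal : AutC <| Aut G.
Proof. by rewrite -aut_modZ_dom ker_normal. Qed.

Lemma AutCP a :
  reflect (a \in Aut G /\ {in G, forall x, coset 'Z(G) (a x) = coset 'Z(G) x})
          (a \in AutC).
Proof.
apply: (iffP idP) => [Ca | [Aa eqa]].
  have Aa := subsetP (normal_sub AutC_normal) a Ca; split=> // x Gx.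
  by rewrite -aut_modZE // (mker Ca) perm1.
apply/kerP; first by rewrite /= aut_modZ_dom.
apply: eq_Aut (aut_modZ_Aut Aa) (group1 _) _ => _ /morphimP[x _ Gx ->].
by rewrite aut_modZE // eqa // perm1.
Qed.

End CentralAutomorphisms.

Section AlgebraAutomorphisms.

Variables (F : finFieldType) (V : finLmodType F) (mul : V -> V -> V).

Definition Aut_alg : {set {perm V}} :=
  [set a : {perm V} | [forall k : F, forall u : V, forall v : V,
              a (k *: u + v)%R == (k *: a u + a v)%R]
         & [forall u : V, forall v : V, a (mul u v) == mul (a u) (a v)]].

Lemma Aut_algP (a : {perm V}) :
  reflect (linear a /\ {morph a : u v / mul u v}) (a \in Aut_alg).
Proof.
rewrite inE; apply: (iffP andP) => -[lin_a mul_a]; split.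
- by move=> k u v; apply/eqP; move/forallP/(_ k)/forallP/(_ u)/forallP: lin_a.
- by move=> u v; apply/eqP; move/forallP/(_ u)/forallP: mul_a.
- do 3!apply/forallP=> ?; exact/eqP/lin_a.
- do 2!apply/forallP=> ?; exact/eqP/mul_a.
Qed.

Lemma Aut_alg_group_set : group_set Aut_alg.
Proof.
apply/group_setP; split=> [|a b /Aut_algP[la ma] /Aut_algP[lb mb]].
  by apply/Aut_algP; split=> [k u v|u v]; rewrite !perm1.
by apply/Aut_algP; split=> [k u v|u v]; rewrite !permM ?la ?lb ?ma ?mb.
Qed.
Canonical Aut_alg_group := Group Aut_alg_group_set.

End AlgebraAutomorphisms.

(* The space G / 'Phi(G), written additively, with its 'F_p-structure.        *)
Definition Lspace (gT : finGroupType) (G : {group gT}) (p : nat)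
    (p_pr : prime p) (pG : p.-group G) : predArgType := [subg G / 'Phi(G)].

Section LspaceTheory.

Variables (gT : finGroupType) (G : {group gT}) (p : nat).
Variables (p_pr : prime p) (pG : p.-group G).

Local Notation Gbar := (G / 'Phi(G)).
Local Notation L := (Lspace p_pr pG).

HB.instance Definition _ := Finite.copy L (subg_of (G / 'Phi(G))%G).

Let addL (u v : L) : L := (u : [subg Gbar]) * (v : [subg Gbar]).
Let oppL (u : L) : L := (u : [subg Gbar])^-1.
Let zeroL : L := (1 : [subg Gbar]).
Let scaleL (k : 'F_p) (u : L) : L := (u : [subg Gbar]) ^+ k.

Let addLA : associative addL. Proof. exact: mulgA. Qed.
Let addLC : commutative addL.
Proof.
move=> u v; apply: val_inj => /=.
by apply: (centsP (abelem_abelian (Phi_quotient_abelem pG))); apply: valP.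
Qed.
Let add0L : left_id zeroL addL. Proof. exact: mul1g. Qed.
Let addNL : left_inverse zeroL oppL addL. Proof. exact: mulVg. Qed.

HB.instance Definition _ := GRing.isZmodule.Build L addLA addLC add0L addNL.

Let expLp (u : [subg Gbar]) : u ^+ p = 1.
Proof.
apply: val_inj; rewrite /= morphX ?inE //=.
have [_] := abelemP p_pr (Phi_quotient_abelem pG).
by apply; apply: subgP.
Qed.
Let exp_modF (u : [subg Gbar]) n :
  u ^+ (n %% (Zp_trunc (pdiv p)).+2) = u ^+ n.
Proof. by rewrite Fp_cast // expg_mod. Qed.

Let scaleLA a b v : scaleL a (scaleL b v) = scaleL (a * b)%R v.
Proof.
by rewrite /scaleL -expgM mulnC /= exp_modF.
Qed.
Let scale1L : left_id 1%R scaleL.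
Proof. by move=> v; rewrite /scaleL /= exp_modF expg1. Qed.
Let scaleLDr : right_distributive scaleL +%R.
Proof.
move=> a u v; rewrite /scaleL; apply: expgMn; exact: addLC.
Qed.
Let scaleLDl v : {morph scaleL^~ v : a b / (a + b)%R}.
Proof.
move=> a b; rewrite /scaleL /= exp_modF; exact: expgD.
Qed.

HB.instance Definition _ :=
  GRing.Zmodule_isLmodule.Build 'F_p L scaleLA scale1L scaleLDr scaleLDl.

Definition Lclass (g : gT) : L := subg Gbar (coset 'Phi(G) g).

(* h^{1/p} for h \in 'Phi(G). For UCS groups of exponent p ^ 2 with p odd,    *)
(* Lroot_ex and Lroot_exp show that the root exists and is unique, LmulE that *)
(* Lmul does not depend on the coset representatives, and Lmul_linearl and    *)
(* Lmul_linearr that it is bilinear.                                          *)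
Definition Lroot (h : gT) : L :=
  if [pick g in G | g ^+ p == h] is Some g then Lclass g else 0%R.

Definition Lmul (u v : L) : L :=
  Lroot [~ repr (sgval u), repr (sgval v)].

Lemma LclassM : {in G &, forall g h, Lclass (g * h) = (Lclass g + Lclass h)%R}.
Proof.
have nPhi := subsetP (normal_norm (Phi_normal G)).
move=> g h Gg Gh; apply: val_inj => /=.
by rewrite !subgK ?mem_quotient ?groupM // morphM ?nPhi.
Qed.

Lemma LclassP (u : L) : exists2 g, g \in G & u = Lclass g.
Proof.
have /morphimP[g _ Gg def_u] := subgP (u : [subg Gbar]).
by exists g => //; apply: val_inj; rewrite /= subgK ?mem_quotient.
Qed.

Hypotheses (p_gt2 : 2 < p) (ucsG : UCS G) (expG : exponent G = (p ^ 2)%N).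

Lemma UCS_neq1 : G :!=: 1.
Proof.
apply: contra_eqN expG => /eqP->; rewrite exponent1 neq_ltn.
by rewrite (ltn_exp2l 0) ?prime_gt1.
Qed.

Lemma Phi_neq1 : 'Phi(G) != 1.
Proof.
rewrite (trivg_Phi pG); apply: contra_eqN expG => abG.
move: abG; rewrite (abelemE _ p_pr) => /andP[_ expGp].
apply: contraTneq expGp => ->.
by rewrite gtnNdvd ?prime_gt0 // ltn_Pmull ?prime_gt1 ?prime_gt0.
Qed.

Lemma UCS_char_eq_Phi (K : {group gT}) :
  K \char G -> K :!=: 1 -> K \proper G -> K :=: 'Phi(G).
Proof.
move=> chK ntK prK; have [H [_ uniqH]] := ucsG.
rewrite -(uniqH K) //; congr gval; apply: uniqH; split=> //=.
- exact: Phi_char.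
- exact: Phi_neq1.
- exact: Phi_proper UCS_neq1.
Qed.

Lemma Phi_UCS_abelem : p.-abelem 'Phi(G).
Proof.
have pPhi := pgroupS (Phi_sub G) pG.
rewrite -(trivg_Phi pPhi); apply: contraT => nt2.
have pr2 := Phi_proper Phi_neq1.
have def2 := UCS_char_eq_Phi (char_trans (Phi_char _) (Phi_char G)) nt2
  (proper_sub_trans pr2 (Phi_sub G)).
by rewrite /= def2 properxx in pr2.
Qed.

Lemma der1_sub_Phi : G^`(1) \subset 'Phi(G).
Proof. by rewrite (Phi_joing pG) joing_subl. Qed.

Lemma Phi_sub_center : 'Phi(G) \subset 'Z(G).
Proof.
have [cGG|ncGG] := boolP (abelian G).
  by rewrite (center_idP cGG) Phi_sub.
rewrite -(UCS_char_eq_Phi (center_char G)) //.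
  by apply: contraNneq UCS_neq1 => /(trivg_center_pgroup pG)->.
by rewrite properEneq center_sub andbT; apply: contraNneq ncGG => <-;
  apply: center_abelian.
Qed.

Lemma comm_in_Phi x y : x \in G -> y \in G -> [~ x, y] \in 'Phi(G).
Proof. by move=> Gx Gy; rewrite (subsetP der1_sub_Phi) // mem_commg. Qed.

Lemma comm_commute x y z :
  x \in G -> y \in G -> z \in G -> commute z [~ x, y].
Proof.
move=> Gx Gy Gz; apply/esym/(centP _ z Gz).
by have /setIP[] := subsetP Phi_sub_center _ (comm_in_Phi Gx Gy).
Qed.

Lemma commJ x y z : x \in G -> y \in G -> z \in G -> [~ x, y] ^ z = [~ x, y].
Proof. by move=> Gx Gy Gz; rewrite conjgE -comm_commute // mulKg. Qed.

Lemma comm_exp_p x y : x \in G -> y \in G -> [~ x, y] ^+ p = 1.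
Proof.
move=> Gx Gy; have [_] := abelemP p_pr Phi_UCS_abelem; apply.
exact: comm_in_Phi.
Qed.

Lemma expg_pM : {in G &, {morph (fun g : gT => g ^+ p) : x y / x * y}}.
Proof.
move=> y x Gy Gx /=; rewrite expMg_Rmul; try exact: comm_commute.
have /dvdnP[k ->] : p %| 'C(p, 2) by rewrite prime_dvd_bin.
by rewrite mulnC expgM comm_exp_p // expg1n mulg1.
Qed.

Let powp : {morphism G >-> gT} := Morphism expg_pM.

Lemma powp_im : powp @* G = 'Phi(G).
Proof.
have defM : powp @* G = 'Mho^1(G).
  by rewrite (MhoE 1 pG) expn1 -(genGid (powp @* G)%G) /= morphimEdom.
have sMPhi : 'Mho^1(G) \subset 'Phi(G) by rewrite (Phi_joing pG) joing_subr.
rewrite defM; apply: UCS_char_eq_Phi; rewrite ?Mho_char //=; last first.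
  exact: sub_proper_trans sMPhi (Phi_proper UCS_neq1).
rewrite -defM; apply: contra_eqN expG => /eqP im1.
have expGp : exponent G %| p.
  apply/exponentP=> x Gx; apply/set1gP; rewrite -im1.
  by apply/morphimP; exists x.
apply: contraTneq expGp => ->.
by rewrite gtnNdvd ?prime_gt0 // ltn_Pmull ?prime_gt1 ?prime_gt0.
Qed.

Lemma powp_ker : 'ker powp = 'Phi(G).
Proof.
apply: UCS_char_eq_Phi.
- rewrite /characteristic subsetIl /=; apply/forall_inP=> a Aa.
  apply/subsetP=> _ /imsetP[x Kx ->]; have Gx := dom_ker Kx.
  apply/kerP; first by rewrite -(autmE Aa) Aut_closed.
  have := mker Kx; rewrite /= -(autmE Aa) -morphX // => ->; exact: morph1.
- apply: contraNneq Phi_neq1 => ker1.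
  rewrite -subG1 -ker1; apply/subsetP=> x Px.
  apply/kerP; first exact: (subsetP (Phi_sub G)).
  by have [_ /(_ x Px)] := abelemP p_pr Phi_UCS_abelem.
- rewrite properEneq subsetIl andbT; apply: contraNneq Phi_neq1 => kerG.
  rewrite -powp_im; apply/eqP/trivgP/subsetP=> _ /morphimP[x _ Gx ->].
  by rewrite -kerG in Gx; apply/set1gP/(mker Gx).
Qed.

Lemma Lroot_exp g : g \in G -> Lroot (g ^+ p) = Lclass g.
Proof.
move=> Gg; rewrite /Lroot; case: pickP => [h /andP[Gh /eqP eq_h]|/(_ g)].
  have nPhi := subsetP (normal_norm (Phi_normal G)).
  have : h \in 'ker powp :* g by apply/(rcoset_kerP powp).
  rewrite powp_ker => /(rcoset_kercosetP (nPhi _ Gh) (nPhi _ Gg)) eq_c.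
  by rewrite /Lclass eq_c.
by rewrite Gg eqxx.
Qed.

Lemma Lroot_ex h : h \in 'Phi(G) -> exists2 g, g \in G & g ^+ p = h.
Proof. by rewrite -powp_im => /morphimP[g _ Gg ->]; exists g. Qed.

Lemma LrootM :
  {in 'Phi(G) &, forall g h, Lroot (g * h) = (Lroot g + Lroot h)%R}.
Proof.
move=> _ _ /Lroot_ex[g Gg <-] /Lroot_ex[h Gh <-].
by rewrite -(expg_pM Gg Gh) !Lroot_exp ?groupM // LclassM.
Qed.

Lemma LmulE x y :
  x \in G -> y \in G -> Lmul (Lclass x) (Lclass y) = Lroot [~ x, y].
Proof.
have nPhi := subsetP (normal_norm (Phi_normal G)).
have reprL g : g \in G -> exists2 z, z \in 'Phi(G) &
    repr (sgval (Lclass g : [subg Gbar])) = z * g.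
  move=> Gg; rewrite subgK ?mem_quotient // val_coset ?nPhi //.
  by have /rcosetP[z Pz ->] := mem_repr_rcoset 'Phi(G) g; exists z.
move=> Gx Gy; rewrite /Lmul; have [z Pz ->] := reprL x Gx.
have [t Pt ->] := reprL y Gy.
have comm1l c g : c \in 'Phi(G) -> g \in G -> [~ c, g] = 1.
  move=> Pc Gg; apply/eqP/commgP.
  by have /setIP[_ /centP] := subsetP Phi_sub_center c Pc; apply.
have Gt := subsetP (Phi_sub G) t Pt.
rewrite commMgJ (comm1l z) ?groupM // conj1g mul1g commgMJ.
suffices -> : [~ x, t] = 1 by rewrite conj1g mulg1.
by apply: invg_inj; rewrite invg_comm invg1 comm1l.
Qed.

Lemma LmulDl u v w : Lmul (u + v)%R w = (Lmul u w + Lmul v w)%R.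
Proof.
case: (LclassP u) (LclassP v) (LclassP w) => [x Gx ->] [y Gy ->] [z Gz ->].
rewrite -LclassM // !LmulE ?groupM // -LrootM ?comm_in_Phi //.
by rewrite commMgJ commJ.
Qed.

Lemma LmulDr u v w : Lmul w (u + v)%R = (Lmul w u + Lmul w v)%R.
Proof.
case: (LclassP u) (LclassP v) (LclassP w) => [x Gx ->] [y Gy ->] [z Gz ->].
rewrite -LclassM // !LmulE ?groupM // -LrootM ?comm_in_Phi // commgMJ commJ //.
by congr Lroot; apply: comm_commute; rewrite ?groupR.
Qed.

Let additive_linear (f : L -> L) : {morph f : u v / (u + v)%R} -> linear f.
Proof.
move=> fD k u v; have f0 : f 0%R = 0%R by apply: (addrI (f 0%R)); rewrite -fD !addr0.
rewrite fD -(natr_Zp k) !scaler_nat; congr (_ + _)%R.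
by elim: (k : nat) => [|n IHn]; rewrite ?mulr0n // !mulrS fD IHn.
Qed.

Lemma Lmul_linearl w : linear (fun u => Lmul u w).
Proof. by apply: additive_linear => u v; apply: LmulDl. Qed.

Lemma Lmul_linearr w : linear (fun u => Lmul w u).
Proof. by apply: additive_linear => u v; apply: LmulDr. Qed.

End LspaceTheory.

Definition Aut_L (gT : finGroupType) (G : {group gT}) (p : nat)
    (p_pr : prime p) (pG : p.-group G) : {group {perm Lspace p_pr pG}} :=
  Aut_alg_group (@Lmul gT G p p_pr pG).

(* Main.v *)
(* Every automorphism of G induces one of L, and since 'Z(G) = 'Phi(G) the     *)
(* kernel of this action is AutC G. For surjectivity, let s be an automorphism *)
(* of L, P <= G x G the group of pairs (x, y) with y in the class s(x 'Phi(G)),*)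
(* and D <= P the graph of the map that s induces on 'Phi(G) through p-th      *)
(* roots. As s preserves the product of L, the commutators and p-th powers of  *)
(* P lie in D, so P / D is elementary abelian and the image of 1 x 'Phi(G) has *)
(* a complement in it; its preimage in P is the graph of an automorphism of G  *)
(* inducing s. Finally, a central automorphism has the form x |-> x * z(x)     *)
(* with z a homomorphism from G to 'Phi(G), i.e., an r x r matrix over 'F_p,   *)
(* since 'Phi(G) and G / 'Phi(G) both have rank r.                             *)

Require Import Defs.
From HB Require Import structures.
From mathcomp Require Import all_boot all_order all_algebra all_fingroup.
From mathcomp Require Import all_solvable mxabelem.

Import GroupScope.

(** The p-th power map is a homomorphism on G with kernel and image both equal to 'Phi(G)
    ([powp_ker], [powp_im]), so 'Phi(G) is a central copy of G / 'Phi(G). Acting on G / 'Phi(G)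
    gives the homomorphism [AutL_of] from [Aut G] to the permutations of L, and the isomorphism is
    the first isomorphism theorem for it: the image is [Aut_L] ([AutL_of_im], whose hard half is
    [AutL_of_lift]) and the kernel is [AutC G] ([AutL_of_ker]). The kernel computation needs 'Z(G) =
    'Phi(G) ([center_UCS]), hence G nonabelian: for abelian G, [AutC G] is all of [Aut G]. The
    structure of [AutC G] follows from [AutC_abelem] and the matrix count [card_AutC]. *)

Lemma Fp_additive_linear p (U V : lmodType 'F_p) (f : U -> V) :
  {morph f : u v / (u + v)%R} -> linear f.
Proof.
move=> fD k u v.
have f0 : f 0%R = 0%R by apply: (GRing.addrI (f 0%R)); rewrite -fD !GRing.addr0.
rewrite fD -(natr_Zp k) !GRing.scaler_nat; congr (_ + _)%R.
by elim: (k : nat) => [|n IHn]; rewrite ?GRing.mulr0n // !GRing.mulrS fD IHn.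
Qed.

Lemma Fp_additive_mx p m n (f : 'rV['F_p]_m -> 'rV['F_p]_n) :
  {morph f : u v / (u + v)%R} -> exists M, forall u, f u = (u *m M)%R.
Proof.
move=> /Fp_additive_linear f_lin.
pose g : {linear 'rV['F_p]_m -> 'rV['F_p]_n} :=
  HB.pack f (GRing.isLinear.Build _ _ _ _ f f_lin).
by exists (lin1_mx g) => u; rewrite mul_rV_lin1.
Qed.

(** Burnside's basis theorem: lifts of generators of the quotient generate G together with 'Phi(G),
    which consists of non-generators. *)
Lemma grank_quotient_Phi (gT : finGroupType) (G : {group gT}) :
  'm(G / 'Phi(G)) = 'm(G).
Proof.
have nPhi := normal_norm (Phi_normal G).
apply/eqP; rewrite eqn_leq quotient_grank //=.
have [B genB <-] := grank_witness (G / 'Phi(G))%G.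
have sBG : B \subset G / 'Phi(G) by rewrite -genB subset_gen.
pose X := [set repr (set_of_coset b) | b in B].
suffices genX : <<X>> = G.
  have -> : 'm(G) = 'm(<<X>>) by rewrite genX.
  exact: leq_trans (grank_min X) (leq_imset_card _ _).
have reprB b : b \in B -> repr b \in G /\ coset 'Phi(G) (repr b) = b.
  move=> /(subsetP sBG)/morphimP[x Nx Gx ->].
  rewrite coset_reprK; split=> //; rewrite val_coset //.
  have /rcosetP[z Pz ->] := mem_repr_rcoset 'Phi(G) x.
  by rewrite groupM // (subsetP (Phi_sub G)).
have sXG : X \subset G.
  by apply/subsetP=> _ /imsetP[b Bb ->]; have [] := reprB b Bb.
apply: Phi_nongen; apply/eqP; rewrite eqEsubset join_subG Phi_sub sXG /=.
rewrite -(quotientSGK nPhi) ?joing_subl //= -genB gen_subG.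
apply/subsetP=> b Bb; have [Gb {1}<-] := reprB b Bb.
apply: mem_quotient; apply: (subsetP (joing_subr _ _)).
exact: imset_f.
Qed.

(** * Classes modulo 'Phi(G) and p-th roots *)

Section UCSExponentP2.

Variables (gT : finGroupType) (G : {group gT}) (p : nat).
Variables (p_pr : prime p) (pG : p.-group G).
Hypotheses (p_gt2 : 2 < p) (ucsG : UCS G) (expG : exponent G = (p ^ 2)%N).

Local Notation L := (Lspace p_pr pG).
Local Notation cl := (Lclass p_pr pG).
Local Notation rt := (Lroot p_pr pG).

Lemma Lclass_eq0 g : g \in G -> (cl g == 0%R) = (g \in 'Phi(G)).
Proof.
have nPhi := subsetP (normal_norm (Phi_normal G)).
move=> Gg; rewrite -(inj_eq val_inj) /= subgK ?mem_quotient //.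
by apply/eqP/idP => [/coset_idr->|/coset_id->] //; apply: nPhi.
Qed.

Lemma Lclass1 : cl 1 = 0%R.
Proof. by apply/eqP; rewrite Lclass_eq0 ?group1. Qed.

Lemma LclassV g : g \in G -> cl g^-1 = (- cl g)%R.
Proof.
move=> Gg; apply/eqP; rewrite -GRing.addr_eq0 -LclassM ?groupV //.
by rewrite mulVg Lclass1.
Qed.

Lemma Phi_expp h : h \in 'Phi(G) -> h ^+ p = 1.
Proof. by have [_] := abelemP p_pr (Phi_UCS_abelem p_pr pG ucsG expG); apply. Qed.

Lemma Lroot_eq0 h : h \in 'Phi(G) -> (rt h == 0%R) = (h == 1).
Proof.
case/(Lroot_ex p_pr pG p_gt2 ucsG expG) => g Gg <-.
rewrite Lroot_exp // Lclass_eq0 //; apply/idP/eqP => [/Phi_expp //|gp1].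
by rewrite -(powp_ker p_pr pG p_gt2 ucsG expG); apply/kerP.
Qed.

Lemma Lroot1 : rt 1 = 0%R.
Proof. by apply/eqP; rewrite Lroot_eq0 ?group1. Qed.

Lemma Lclass_eqP g h :
  g \in G -> h \in G -> reflect (cl g = cl h) (g^-1 * h \in 'Phi(G)).
Proof.
move=> Gg Gh; rewrite -Lclass_eq0 ?groupM ?groupV // LclassM ?groupV //.
by rewrite LclassV // GRing.addrC GRing.subr_eq0 eq_sym; apply: eqP.
Qed.

(** * The homomorphism from [Aut G] to [Aut_L] *)

Lemma Lclass_Aut a g : a \in Aut G -> g \in G -> cl g = 0%R -> cl (a g) = 0%R.
Proof.
move=> Aa Gg /eqP; rewrite Lclass_eq0 // => Pg; apply/eqP.
rewrite Lclass_eq0; last by rewrite -(autmE Aa) Aut_closed.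
have /charP[_ /(_ (autm_morphism Aa) (injm_autm Aa) (im_autm Aa))<-] := Phi_char G.
by rewrite -(autmE Aa) mem_morphim.
Qed.

(** Found by search so as to be total; for [a] in [Aut G] the search succeeds ([AutL_ofE]), and the
    default 1 never occurs. *)
Definition AutL_of (a : {perm gT}) : {perm L} :=
  odflt 1 [pick s : {perm L} | [forall g in G, s (cl g) == cl (a g)]].

Lemma AutL_ofE a g : a \in Aut G -> g \in G -> AutL_of a (cl g) = cl (a g).
Proof.
move=> Aa Gg; rewrite /AutL_of; case: pickP => [s /forall_inP/(_ g Gg)/eqP //|no_s].
have GA b x : b \in Aut G -> x \in G -> b x \in G.
  by move=> Ab Gx; rewrite -(autmE Ab) Aut_closed.
have clA b x y : b \in Aut G -> x \in G -> y \in G -> cl x = cl y -> cl (b x) = cl (b y).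
  move=> Ab Gx Gy eqxy; apply/eqP; rewrite -GRing.subr_eq0.
  rewrite -LclassV ?GA // -LclassM ?groupV ?GA //.
  rewrite -!(autmE Ab) -morphV // -morphM ?groupV //; apply/eqP.
  apply: Lclass_Aut; rewrite ?groupM ?groupV // LclassM ?groupV // LclassV //.
  by rewrite eqxy GRing.subrr.
pose rep (u : L) := odflt 1 [pick x in G | cl x == u].
have repP u : rep u \in G /\ cl (rep u) = u.
  rewrite /rep; case: pickP => [x /andP[Gx /eqP] //|].
  by have [x Gx ->] := LclassP u => /(_ x); rewrite Gx eqxx.
(* Injective because the inverse of [a] also respects classes. *)
have inj_s : injective (fun u : L => cl (a (rep u))).
  move=> u v eq_uv; have [[Gu <-] [Gv <-]] := (repP u, repP v).
  have := clA _ _ _ (groupVr Aa) (GA _ _ Aa Gu) (GA _ _ Aa Gv) eq_uv.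
  by rewrite !permK.
have /idP[] := no_s (perm inj_s); apply/forall_inP => x Gx; apply/eqP.
by rewrite permE; have [Gr eqr] := repP (cl x); apply: clA.
Qed.

Lemma AutL_of_M : {in Aut G &, {morph AutL_of : a b / a * b}}.
Proof.
move=> a b Aa Ab; apply/permP => u; have [g Gg ->] := LclassP u.
rewrite permM !AutL_ofE ?groupM // -?(autmE Aa) ?Aut_closed //.
by rewrite permM autmE.
Qed.

Canonical AutL_of_morphism := Morphism AutL_of_M.

(** An automorphism commutes with commutators and p-th powers, hence with p-th roots. *)
Lemma AutL_of_in a : a \in Aut G -> AutL_of a \in Aut_L p_pr pG.
Proof.
move=> Aa; have Ga x : x \in G -> a x \in G by move=> Gx; rewrite -(autmE Aa) Aut_closed.
apply/Aut_algP; split.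
  apply: Fp_additive_linear => u v; have [[x Gx ->] [y Gy ->]] := (LclassP u, LclassP v).
  rewrite -LclassM // !AutL_ofE ?groupM // -LclassM ?Ga //.
  by rewrite -(autmE Aa) morphM.
move=> u v; have [[x Gx ->] [y Gy ->]] := (LclassP u, LclassP v).
rewrite LmulE // !AutL_ofE // LmulE ?Ga //.
have [z Gz def_z] := Lroot_ex p_pr pG p_gt2 ucsG expG (comm_in_Phi pG Gx Gy).
rewrite -def_z Lroot_exp // AutL_ofE // -(Lroot_exp p_pr pG p_gt2 ucsG expG) ?Ga //.
by rewrite -!(autmE Aa) -morphX // def_z morphR.
Qed.

(** * Surjectivity: lifting an automorphism of L to G *)

Section Lift.

Variable s : {perm L}.
Hypothesis Ls : s \in Aut_L p_pr pG.

Let sD u v : s (u + v)%R = (s u + s v)%R.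
Proof.
by have /Aut_algP[/(_ 1%R u v)] := Ls; rewrite !GRing.scale1r.
Qed.

Let sM u v : s (Lmul u v) = Lmul (s u) (s v).
Proof. by have /Aut_algP[_] := Ls; apply. Qed.

Let s0 : s 0%R = 0%R.
Proof. by apply: (GRing.addrI (s 0%R)); rewrite -sD !GRing.addr0. Qed.

(** The group P: a fibre product of two copies of G over L, which contains the graph of every
    automorphism inducing [s]. *)
Definition lift_pairs : {set gT * gT} :=
  [set u | [&& u.1 \in G, u.2 \in G & s (cl u.1) == cl u.2]].

(** The group D. A lift of [s] respects p-th powers, so its graph must contain D. *)
Definition Phi_pairs : {set gT * gT} :=
  [set u | [&& u.1 \in 'Phi(G), u.2 \in 'Phi(G) & s (rt u.1) == rt u.2]].

Lemma lift_pairs_group_set : group_set lift_pairs.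
Proof.
apply/group_setP; split=> [|[x y] [z t]]; rewrite !inE /=.
  by rewrite !group1 Lclass1 s0 eqxx.
case/and3P=> Gx Gy /eqP sxy /and3P[Gz Gt /eqP szt].
by rewrite !groupM //= !LclassM // sD sxy szt.
Qed.
Canonical lift_pairs_group := Group lift_pairs_group_set.

Lemma Phi_pairs_group_set : group_set Phi_pairs.
Proof.
apply/group_setP; split=> [|[x y] [z t]]; rewrite !inE /=.
  by rewrite !group1 Lroot1 s0 eqxx.
case/and3P=> Gx Gy /eqP sxy /and3P[Gz Gt /eqP szt].
by rewrite !groupM //= !LrootM // sD sxy szt.
Qed.
Canonical Phi_pairs_group := Group Phi_pairs_group_set.

Lemma pair_expg (x y : gT) n : (x, y) ^+ n = (x ^+ n, y ^+ n).
Proof. by elim: n => // n IHn; rewrite !expgS IHn. Qed.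

Lemma lift_pairs_expp u : u \in lift_pairs -> u ^+ p \in Phi_pairs.
Proof.
have PhiX x : x \in G -> x ^+ p \in 'Phi(G).
  by move=> Gx; rewrite -(powp_im p_pr pG p_gt2 ucsG expG); apply/morphimP; exists x.
case: u => x y; rewrite pair_expg !inE /= => /and3P[Gx Gy sxy].
by rewrite !PhiX // !Lroot_exp.
Qed.

Lemma lift_pairs_norm : lift_pairs \subset 'N(Phi_pairs).
Proof.
apply/cents_norm/centsP => -[x y] /[!inE] /= /and3P[Gx Gy _].
move=> [z t] /[!inE] /= /and3P[Pz Pt _].
have ZPhi := subsetP (Phi_sub_center p_pr pG ucsG expG).
have [[_ /centP/(_ x Gx) cxz] [_ /centP/(_ y Gy) cyt]] :=
  (setIP (ZPhi z Pz), setIP (ZPhi t Pt)).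
by congr (_, _); symmetry.
Qed.

Lemma lift_pairs_abelem : p.-abelem (lift_pairs / Phi_pairs).
Proof.
apply/abelemP => //; split=> [|_ /morphimP[u Nu Pu ->]]; last first.
  by rewrite -morphX //= coset_id ?lift_pairs_expp.
apply: sub_der1_abelian; rewrite gen_subG; apply/subsetP.
move=> _ /imset2P[[x y] [z t] + + ->]; rewrite !inE /=.
case/and3P=> Gx Gy /eqP sxy /and3P[Gz Gt /eqP szt].
(* Roots of commutators are products in L, so the remaining condition is that [s] preserves the
   product. *)
rewrite !(comm_in_Phi pG) //= -(LmulE p_pr pG ucsG expG) //.
by rewrite sM sxy szt LmulE.
Qed.

(* The graph is the preimage in lift_pairs of a complement of the image of     *)
(* 1 x 'Phi(G) in the elementary abelian group lift_pairs / Phi_pairs.         *)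
Lemma lift_graph_ex : exists2 K : {group gT * gT}, K \subset lift_pairs
  & forall x, x \in G -> exists2 y, (x, y) \in K & forall z, (x, z) \in K -> z = y.
Proof.
have nD := lift_pairs_norm.
pose W := setX_group [1 gT] 'Phi(G)%G.
have sWP : W \subset lift_pairs.
  apply/subsetP=> -[x y] /setXP[/set1P-> Py]; rewrite inE /= group1.
  have Gy := subsetP (Phi_sub G) y Py.
  by rewrite Gy Lclass1 s0 eq_sym Lclass_eq0.
have /splitsP[C /complP[tiWC defP]] :=
  abelem_splits lift_pairs_abelem (quotientS Phi_pairs sWP).
exists (coset Phi_pairs @*^-1 C :&: lift_pairs)%G; first exact: subsetIr.
have KE u : (u \in coset Phi_pairs @*^-1 C :&: lift_pairs) =
    (coset Phi_pairs u \in C) && (u \in lift_pairs).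
  rewrite in_setI; have [Pu|] := boolP (u \in lift_pairs); last by rewrite !andbF.
  by rewrite !andbT; apply/morphpreP/idP=> [[]//|]; split; rewrite // (subsetP nD).
move=> x Gx; have [y0 Gy0 sx] := LclassP (s (cl x)).
have Pxy0 : (x, y0) \in lift_pairs by rewrite inE /= Gx Gy0 sx eqxx.
have: coset Phi_pairs (x, y0) \in lift_pairs / Phi_pairs by rewrite mem_quotient.
rewrite -defP => /mulsgP[_ c /morphimP[w Nw Ww ->] Cc eq_wc].
(* Dividing by the W-component [w] moves [(x, y0)] into the complement without changing its first
   coordinate. *)
have Pw := subsetP sWP w Ww.
have Kwxy : w^-1 * (x, y0) \in coset Phi_pairs @*^-1 C :&: lift_pairs.
  rewrite KE groupM ?groupV // andbT morphM ?morphV ?(subsetP nD) ?groupV //=.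
  by rewrite eq_wc mulKg.
case: w Ww Kwxy {eq_wc Nw Pw} => w1 w /setXP[/set1P-> Pw] Kwxy.
have Kxy : (x, w^-1 * y0) \in coset Phi_pairs @*^-1 C :&: lift_pairs.
  suffices <- : (1, w)^-1 * (x, y0) = (x, w^-1 * y0) by [].
  by congr (_, _); rewrite /= invg1 mul1g.
exists (w^-1 * y0) => // z Kxz; set y := w^-1 * y0 in Kxy *.
(* Two values at [x] differ by an element of W whose image lies in C, hence is trivial; so it is in
   D, whose only element of the form (1, t) is 1. *)
have: (x, y)^-1 * (x, z) \in coset Phi_pairs @*^-1 C :&: lift_pairs.
  by rewrite groupM ?groupV.
have -> : (x, y)^-1 * (x, z) = (1, y^-1 * z) by congr (_, _); rewrite /= mulVg.
rewrite KE => /andP[Cyz]; rewrite inE /= group1 Lclass1 s0 /= => /andP[Gyz].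
rewrite eq_sym Lclass_eq0 // => Pyz.
have: coset Phi_pairs (1, y^-1 * z) \in W / Phi_pairs :&: C.
  rewrite inE Cyz andbT mem_quotient //; apply/setXP; split=> //; exact: set11.
rewrite tiWC => /set1P/coset_idr yzD.
have: (1, y^-1 * z) \in Phi_pairs.
  by apply/yzD/(subsetP nD); rewrite inE /= group1 Gyz Lclass1 s0 eq_sym Lclass_eq0.
rewrite inE /= group1 Lroot1 s0 Pyz /= eq_sym Lroot_eq0 // => /eqP yz1.
by rewrite -[z](mulKVg y) yz1 mulg1.
Qed.

Lemma AutL_of_lift : exists2 a, a \in Aut G & AutL_of a = s.
Proof.
have [K sKP graphK] := lift_graph_ex.
pose f x := odflt 1 [pick y | (x, y) \in K].
have fP x : x \in G -> (x, f x) \in K.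
  rewrite /f => /graphK[y Kxy _]; case: pickP => [//|/(_ y)].
  by rewrite Kxy.
have f_uniq x y : (x, y) \in K -> f x = y.
  move=> Kxy; have Gx : x \in G by have /(subsetP sKP)/[!inE]/and3P[] := Kxy.
  by have [z _ uz] := graphK x Gx; rewrite (uz _ Kxy) (uz _ (fP x Gx)).
have fPP x : x \in G -> f x \in G /\ s (cl x) = cl (f x).
  by move=> /fP/(subsetP sKP); rewrite inE /= => /and3P[_ Gfx /eqP].
have fM : {in G &, {morph f : x y / x * y}}.
  move=> x y Gx Gy; apply: f_uniq.
  by have := groupM (fP x Gx) (fP y Gy).
pose fm := Morphism fM.
have fPhi x : x \in G -> f x \in 'Phi(G) -> x \in 'Phi(G).
  move=> Gx; have [Gfx sx] := fPP x Gx.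
  by rewrite -!Lclass_eq0 // -sx -{1}s0 (inj_eq perm_inj).
(* If f x = 1 then x is in 'Phi(G), say x = y ^+ p; then (f y) ^+ p = 1 puts f y, hence y, in
   'Phi(G), and x = 1. *)
have inj_f : 'injm fm.
  apply/subsetP=> x /[dup] /dom_ker Gx /mker /= fx1; apply/set1P.
  have Px : x \in 'Phi(G) by apply: fPhi; rewrite ?fx1.
  have [y Gy def_x] := Lroot_ex p_pr pG p_gt2 ucsG expG Px.
  rewrite -def_x; apply/Phi_expp/fPhi => //.
  rewrite -(powp_ker p_pr pG p_gt2 ucsG expG); apply/kerP; first by have [] := fPP y Gy.
  by rewrite /= -(morphX fm) //= def_x.
have im_f : fm @* G = G.
  apply/eqP; rewrite eqEcard card_injm // leqnn andbT.
  by apply/subsetP=> _ /morphimP[x _ Gx ->]; have [] := fPP x Gx.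
exists (aut inj_f im_f); first exact: Aut_aut.
apply/permP=> u; have [x Gx ->] := LclassP u.
rewrite AutL_ofE ?Aut_aut // autE //=.
by have [_ ->] := fPP x Gx.
Qed.

End Lift.

Lemma AutL_of_im : AutL_of @* Aut G = Aut_L p_pr pG.
Proof.
apply/eqP; rewrite eqEsubset; apply/andP; split; apply/subsetP.
  by move=> _ /morphimP[a _ Aa ->]; apply: AutL_of_in.
by move=> s /AutL_of_lift[a Aa <-]; rewrite mem_morphim.
Qed.

(** * The kernel: central automorphisms of nonabelian G *)

Section Nonabelian.

Hypothesis nabG : ~~ abelian G.

Lemma center_UCS : 'Z(G) = 'Phi(G).
Proof.
apply: (UCS_char_eq_Phi p_pr pG ucsG expG (center_char G)).
  by apply: contraNneq (UCS_neq1 p_pr expG) => /(trivg_center_pgroup pG)->.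
rewrite properEneq center_sub andbT; apply: contraNneq nabG => <-.
exact: center_abelian.
Qed.

Lemma AutC_PhiP a :
  reflect (a \in Aut G /\ {in G, forall x, x^-1 * a x \in 'Phi(G)}) (a \in AutC G).
Proof.
have nZ := subsetP (normal_norm (center_normal G)).
have eqP_Z x y : x \in G -> y \in G ->
    reflect (coset 'Z(G) y = coset 'Z(G) x) (x^-1 * y \in 'Phi(G)).
  move=> Gx Gy; rewrite -center_UCS; apply: (iffP idP) => [Zxy | eq_xy].
    by rewrite -[y](mulKVg x) morphM ?nZ ?groupM ?groupV //= (coset_id Zxy) mulg1.
  apply: coset_idr; first by rewrite nZ ?groupM ?groupV.
  by rewrite morphM ?morphV ?nZ ?groupV //= eq_xy mulVg.
apply: (iffP (AutCP G a)) => -[Aa Ca]; split=> // x Gx;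
  by apply/eqP_Z; rewrite ?Ca // -(autmE Aa) Aut_closed.
Qed.

(** As 'Z(G) = 'Phi(G), acting trivially on L and on G / 'Z(G) are the same condition. *)
Lemma AutL_of_ker : 'ker AutL_of = AutC G.
Proof.
apply/setP => a; apply/idP/AutC_PhiP => [Ka | [Aa Ca]].
  have Aa := dom_ker Ka; split=> // x Gx.
  apply/Lclass_eqP; rewrite // -?(autmE Aa) ?Aut_closed //.
  by rewrite autmE -AutL_ofE // (mker Ka) perm1.
apply/kerP => //; apply/permP => u; have [x Gx ->] := LclassP u.
rewrite AutL_ofE // perm1; apply/esym/Lclass_eqP; rewrite ?Ca //.
by rewrite -(autmE Aa) Aut_closed.
Qed.

(** With h = x ^+ p and a x = x * z, z in 'Phi(G), the power z ^+ p vanishes. *)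
Lemma AutC_id_Phi a h : a \in AutC G -> h \in 'Phi(G) -> a h = h.
Proof.
case/AutC_PhiP=> Aa Ca /(Lroot_ex p_pr pG p_gt2 ucsG expG)[x Gx <-].
rewrite -(autmE Aa) morphX //= autmE -[a x](mulKVg x).
have Gz := subsetP (Phi_sub G) _ (Ca x Gx).
by have /= -> := expg_pM p_pr pG p_gt2 ucsG expG Gx Gz;
  rewrite (Phi_expp _ (Ca x Gx)) mulg1.
Qed.

(** Since [b] fixes 'Phi(G) pointwise, displacements multiply; [AutC G] thus inherits commutativity
    and exponent p from 'Phi(G). *)
Lemma AutCM a b x : a \in AutC G -> b \in AutC G -> x \in G ->
  (a * b) x = x * ((x^-1 * a x) * (x^-1 * b x)).
Proof.
move=> Ca Cb Gx; have [[Aa Pa] [Ab Pb]] := (AutC_PhiP a Ca, AutC_PhiP b Cb).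
have Zbx : commute (x^-1 * a x) (x^-1 * b x).
  have cPP := abelem_abelian (Phi_UCS_abelem p_pr pG ucsG expG).
  by apply: (centsP cPP); [apply: Pa | apply: Pb].
have Gax := subsetP (Phi_sub G) _ (Pa x Gx).
rewrite permM -{1}[a x](mulKVg x) (morphicP (Aut_morphic Ab)) //.
by rewrite (AutC_id_Phi _ _ Cb (Pa x Gx)) Zbx -{1}[b x](mulKVg x) -mulgA.
Qed.

Lemma AutC_abelem : p.-abelem (AutC G).
Proof.
have cPP := centsP (abelem_abelian (Phi_UCS_abelem p_pr pG ucsG expG)).
have sCA := subsetP (normal_sub (AutC_normal G)).
apply/abelemP => //; split.
  apply/centsP=> a Ca b Cb; apply: (@eq_Aut _ G); rewrite ?groupM ?sCA // => x Gx.
  have [[_ Pa] [_ Pb]] := (AutC_PhiP a Ca, AutC_PhiP b Cb).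
  by rewrite !AutCM // (cPP _ (Pa x Gx) _ (Pb x Gx)).
move=> a Ca; have [Aa Pa] := AutC_PhiP a Ca.
apply: (@eq_Aut _ G); rewrite ?groupX ?group1 // => x Gx.
have aX n : x^-1 * (a ^+ n) x = (x^-1 * a x) ^+ n.
  elim: n => [|n IHn]; first by rewrite perm1 mulVg.
  by rewrite !expgS AutCM ?groupX // mulKg IHn.
by rewrite -[_ x](mulKVg x) aX Phi_expp ?Pa // mulg1 perm1.
Qed.

(** * Counting central automorphisms by matrices *)

Lemma card_Phi_UCS : #|'Phi(G)| = #|G / 'Phi(G)|.
Proof.
rewrite -{1}(powp_im p_pr pG p_gt2 ucsG expG) -(card_isog (first_isog _)).
by rewrite powp_ker.
Qed.

Lemma Phi_quotient_neq1 : G / 'Phi(G) != 1.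
Proof.
by rewrite -cardG_gt1 -card_Phi_UCS cardG_gt1 (Phi_neq1 p_pr pG expG).
Qed.

Let abE := Phi_quotient_abelem pG.
Let abP := Phi_UCS_abelem p_pr pG ucsG expG.
Let ntE := Phi_quotient_neq1.
Let ntP := Phi_neq1 p_pr pG expG.
Let nPhi := subsetP (normal_norm (Phi_normal G)).

(** The homomorphism from G to 'Phi(G), through G / 'Phi(G), whose matrix is [M] in row-vector
    coordinates. *)
Definition mx_twist (M : 'M['F_p]_('dim (G / 'Phi(G)), 'dim 'Phi(G))) x : gT :=
  rVabelem abP ntP (abelem_rV abE ntE (coset 'Phi(G) x) *m M)%R.

Lemma mx_twist_Phi M x : mx_twist M x \in 'Phi(G).
Proof. exact: mem_rVabelem. Qed.

Lemma mx_twistM M : {in G &, {morph mx_twist M : x y / x * y}}.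
Proof.
move=> x y Gx Gy; rewrite /mx_twist morphM ?nPhi //=.
by rewrite abelem_rV_M ?mem_quotient // mulmxDl rVabelemD.
Qed.

Lemma mx_twist_inj M N : {in G, mx_twist M =1 mx_twist N} -> M = N.
Proof.
move=> eqMN; apply/row_matrixP=> i; rewrite !rowE; apply: (@rVabelem_inj _ _ _ abP ntP).
have /morphimP[x Nx Gx def_x] := mem_rVabelem abE ntE (delta_mx 0%R i).
by have := eqMN x Gx; rewrite /mx_twist -def_x rVabelemK.
Qed.

Lemma mx_twist_AutC M :
  exists2 a, a \in AutC G & {in G, forall x, a x = x * mx_twist M x}.
Proof.
have ZPhi := subsetP (Phi_sub_center p_pr pG ucsG expG).
have GPhi := subsetP (Phi_sub G).
have fM : {in G &, {morph (fun x => x * mx_twist M x) : x y / x * y}}.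
  move=> x y Gx Gy /=; rewrite mx_twistM // !mulgA; congr (_ * _); rewrite -!mulgA.
  by congr (_ * _); have [_ /centP->] := setIP (ZPhi _ (mx_twist_Phi M x)).
pose f := Morphism fM.
(* A kernel element is the inverse of its twist, so it lies in 'Phi(G), where the twist is
   trivial. *)
have inj_f : 'injm f.
  apply/subsetP=> x /[dup] /dom_ker Gx /mker /= fx1; apply/set1P.
  have Px : x \in 'Phi(G).
    by rewrite -(mulgK (mx_twist M x) x) fx1 mul1g groupV mx_twist_Phi.
  move: fx1; rewrite /mx_twist (coset_id Px) abelem_rV_1.
  by rewrite mul0mx rVabelem0 mulg1.
have im_f : f @* G = G.
  apply/eqP; rewrite eqEcard card_injm // leqnn andbT.
  by apply/subsetP=> _ /morphimP[x _ Gx ->]; rewrite /= groupM // GPhi ?mx_twist_Phi.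
exists (aut inj_f im_f) => [|x Gx]; last by rewrite autE.
apply/AutC_PhiP; split=> [|x Gx]; first exact: Aut_aut.
by rewrite autE //= mulKg mx_twist_Phi.
Qed.

(** The displacement is a homomorphism because its values are central, and it kills 'Phi(G) by
    [AutC_id_Phi]; so it factors through G / 'Phi(G) as an 'F_p-linear map. *)
Lemma AutC_mx_twist a : a \in AutC G ->
  exists M, {in G, forall x, a x = x * mx_twist M x}.
Proof.
move=> Ca; have [Aa Pa] := AutC_PhiP a Ca.
pose z x := x^-1 * a x.
have zM : {in G &, {morph z : x y / x * y}}.
  move=> x y Gx Gy; rewrite /z invMg (morphicP (Aut_morphic Aa)) //.
  have := subsetP (Phi_sub_center p_pr pG ucsG expG) _ (Pa x Gx).
  case/setIP=> _ /centP/(_ y^-1 (groupVr Gy)) cz.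
  by rewrite -mulgA (mulgA x^-1) (mulgA y^-1) -cz !mulgA.
have z_coset x y : x \in G -> y \in G -> coset 'Phi(G) x = coset 'Phi(G) y -> z x = z y.
  move=> Gx Gy /(rcoset_kercosetP (nPhi _ Gx) (nPhi _ Gy))/rcosetP[h Ph ->].
  have Gh := subsetP (Phi_sub G) h Ph.
  by rewrite zM // {1}/z (AutC_id_Phi _ _ Ca) // mulVg mul1g.
pose rep u := repr (set_of_coset (rVabelem abE ntE u)).
have repP u : rep u \in G /\ coset 'Phi(G) (rep u) = rVabelem abE ntE u.
  split; last exact: coset_reprK.
  have /morphimP[x Nx Gx def_x] := mem_rVabelem abE ntE u.
  rewrite /rep def_x val_coset //.
  have /rcosetP[h Ph ->] := mem_repr_rcoset 'Phi(G) x.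
  by rewrite groupM // (subsetP (Phi_sub G)).
pose f u := abelem_rV abP ntP (z (rep u)).
have fD : {morph f : u v / (u + v)%R}.
  move=> u v; have [[Gu cu] [Gv cv]] := (repP u, repP v).
  have [Guv cuv] := repP (u + v)%R.
  rewrite /f -abelem_rV_M ?Pa // -zM //; congr (abelem_rV abP ntP _).
  by apply: z_coset; rewrite ?groupM // morphM ?nPhi //= cu cv cuv rVabelemD.
have [M fE] := Fp_additive_mx _ _ _ _ fD; exists M => x Gx.
rewrite /mx_twist -fE /f abelem_rV_K ?Pa ?(repP _).1 //.
have [Gr cr] := repP (abelem_rV abE ntE (coset 'Phi(G) x)).
rewrite (z_coset _ x) // ?mulKVg // cr abelem_rV_K //; exact: mem_quotient.
Qed.

Lemma card_AutC : #|AutC G| = (p ^ ('m(G) ^ 2))%N.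
Proof.
have dimE : 'dim (G / 'Phi(G)) = 'm(G).
  rewrite (dim_abelemE abE ntE) -grank_quotient_Phi.
  by rewrite grank_abelian ?(abelem_abelian abE) // (rank_abelem abE).
have dimP : 'dim 'Phi(G) = 'm(G).
  by rewrite (dim_abelemE abP ntP) card_Phi_UCS -(dim_abelemE abE ntE).
(* By [mx_twist_AutC] the default is never taken; F is a bijection from r x r matrices onto
   [AutC G]. *)
pose F M := odflt 1 [pick a in AutC G | [forall x in G, a x == x * mx_twist M x]].
have FP M : F M \in AutC G /\ {in G, forall x, F M x = x * mx_twist M x}.
  rewrite /F; case: pickP => [a /andP[Ca /forall_inP/= aE] | no_a].
    by split=> // x Gx; apply/eqP/aE.
  have [a Ca aE] := mx_twist_AutC M; have /andP[] := no_a a.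
  by split=> //; apply/forall_inP => x Gx; rewrite aE.
have injF : injective F.
  move=> M N eqF; apply: mx_twist_inj => x Gx; apply: (mulgI x).
  by rewrite -(FP M).2 // -(FP N).2 // eqF.
have -> : AutC G = F @: setT.
  apply/setP=> a; apply/idP/imsetP=> [Ca | [M _ ->]]; last exact: (FP M).1.
  have [M aE] := AutC_mx_twist _ Ca; exists M; first by rewrite inE.
  apply: (@eq_Aut _ G) => [||x Gx]; last by rewrite aE // (FP M).2.
    by have [] := AutC_PhiP a Ca.
  by have [] := AutC_PhiP _ (FP M).1.
by rewrite card_imset // cardsT card_mx card_Fp // dimE dimP mulnn.
Qed.

End Nonabelian.

End UCSExponentP2.

Theorem theorem3p6 (gT : finGroupType) (G : {group gT}) (p r : nat)
    (p_pr : prime p) (p_gt2 : (2 < p)%N) (pG : p.-group G)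
    (ucsG : UCS G) (expG : exponent G = (p ^ 2)%N) (rG : 'm(G) = r)
    (nabG : ~~ abelian G) :
  [/\ (Aut G / AutC G) \isog Aut_L p_pr pG,
      p.-abelem (AutC G) & #|AutC G| = (p ^ (r ^ 2))%N].
Proof.
rewrite -rG (card_AutC _ _ _ p_pr pG) //; split=> //.
  rewrite -(AutL_of_im _ _ _ p_pr pG p_gt2 ucsG expG).
  rewrite -(AutL_of_ker _ _ _ p_pr pG ucsG expG nabG).
  exact: first_isog.
exact: (AutC_abelem _ _ _ p_pr pG).
Qed.
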